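(* Let ${\bf Y}$, $d^\pi_Y$, $\xi$ satisfy axioms (1)–(4), and let $\mathcal P_K({\bf Y})$ be the projection complex defined below. There is $K_0$ such that for every $K\ge K_0$, $\mathcal P_K({\bf Y})$ is a quasi-tree, i.e. it is quasi-isometric to a simplicial tree.
   Context: Axioms: ${\bf Y}$ is a set, for each $Y\in{\bf Y}$, $d^\pi_Y:({\bf Y}\setminus\{Y\})^2\to[0,\infty)$, and $\xi>0$, with (1) $d^\pi_Y(X,Z)=d^\pi_Y(Z,X)$; (2) $d^\pi_Y(X,Z)+d^\pi_Y(Z,W)\ge d^\pi_Y(X,W)$; (3) for pairwise distinct $X,Y,Z$, $\min\{d^\pi_Y(X,Z),d^\pi_Z(X,Y)\}<\xi$; (4) for all $X,Z$ the set $\{Y:d^\pi_Y(X,Z)\ge\xi\}$ is finite. Let $\mathcal H(X,Z)$ be the set of pairs $(X',Z')$ such that either $d^\pi_X(X',Z')>2\xi$ and $d^\pi_Z(X',Z')>2\xi$; or $X'=X$ and $d^\pi_Z(X,Z')>2\xi$; or $Z'=Z$ and $d^\pi_X(X',Z)>2\xi$; or $(X',Z')=(X,Z)$. Define $d_Y(X,Z)=\inf_{(X',Z')\in\mathcal H(X,Z)}d^\pi_Y(X',Z')$ and ${\bf Y}_K(X,Z)=\{Y\in{\bf Y}\setminus\{X,Z\}:d_Y(X,Z)>K\}$. $\mathcal P_K({\bf Y})$ is the graph with vertex set ${\bf Y}$ in which distinct $X,Z$ are joined by an edge of length 1 iff ${\bf Y}_K(X,Z)=\emptyset$. *)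

(* Defs.v *)
From Stdlib Require Import Reals List.
From Coquelicot Require Import Coquelicot.
Open Scope R_scope.

(* ---------- Projection axioms (1)-(4) ----------
   dpi Y X Z stands for d^pi_Y(X,Z); it is only meaningful for X <> Y, Z <> Y
   (values outside that domain are never used). *)
Definition projection_axioms {T : Type} (dpi : T -> T -> T -> R) (xi : R) : Prop :=
  xi > 0 /\
  (forall Y X Z, X <> Y -> Z <> Y -> 0 <= dpi Y X Z) /\
  (forall Y X Z, X <> Y -> Z <> Y -> dpi Y X Z = dpi Y Z X) /\
  (forall Y X Z W, X <> Y -> Z <> Y -> W <> Y ->
      dpi Y X Z + dpi Y Z W >= dpi Y X W) /\
  (forall X Y Z, X <> Y -> Y <> Z -> X <> Z ->
      Rmin (dpi Y X Z) (dpi Z X Y) < xi) /\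
  (forall X Z, exists l : list T, forall Y, Y <> X -> Y <> Z ->
      dpi Y X Z >= xi -> In Y l).

Definition Hpair {T : Type} (dpi : T -> T -> T -> R) (xi : R) (X Z X' Z' : T) : Prop :=
  (X' <> X /\ Z' <> X /\ X' <> Z /\ Z' <> Z /\
     dpi X X' Z' > 2 * xi /\ dpi Z X' Z' > 2 * xi) \/
  (X' = X /\ X <> Z /\ Z' <> Z /\ dpi Z X Z' > 2 * xi) \/
  (Z' = Z /\ X' <> X /\ Z <> X /\ dpi X X' Z > 2 * xi) \/
  (X' = X /\ Z' = Z).

Definition dmod {T : Type} (dpi : T -> T -> T -> R) (xi : R) (Y X Z : T) : Rbar :=
  Glb_Rbar (fun r => exists X' Z', Hpair dpi xi X Z X' Z' /\ X' <> Y /\ Z' <> Y /\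
                                   r = dpi Y X' Z').

Definition inYK {T : Type} (dpi : T -> T -> T -> R) (xi K : R) (X Z Y : T) : Prop :=
  Y <> X /\ Y <> Z /\ Rbar_lt (Finite K) (dmod dpi xi Y X Z).

Definition PK_adj {T : Type} (dpi : T -> T -> T -> R) (xi K : R) (X Z : T) : Prop :=
  X <> Z /\ (forall Y, ~ inYK dpi xi K X Z Y).

Inductive walk {V : Type} (adj : V -> V -> Prop) : nat -> V -> V -> Prop :=
| walk0 : forall x, walk adj 0 x x
| walkS : forall n x y z, adj x y -> walk adj n y z -> walk adj (S n) x z.

Definition gconnected {V : Type} (adj : V -> V -> Prop) : Prop :=
  forall x y, exists n, walk adj n x y.

Definition gdist {V : Type} (adj : V -> V -> Prop) (x y : V) : R :=
  real (Glb_Rbar (fun r => exists n, walk adj n x y /\ r = INR n)).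

Fixpoint chain {V : Type} (adj : V -> V -> Prop) (l : list V) : Prop :=
  match l with
  | x :: ((y :: _) as t) => adj x y /\ chain adj t
  | _ => True
  end.

Definition has_cycle {V : Type} (adj : V -> V -> Prop) : Prop :=
  exists (l : list V) (x0 : V),
    (3 <= length l)%nat /\ NoDup l /\ chain adj l /\
    adj (last l x0) (hd x0 l).

Definition simplicial_tree {V : Type} (adj : V -> V -> Prop) : Prop :=
  (forall x y, adj x y -> adj y x) /\ (forall x, ~ adj x x) /\
  gconnected adj /\ ~ has_cycle adj.

Definition quasi_isometric_graphs {U V : Type} (adjU : U -> U -> Prop)
    (adjV : V -> V -> Prop) : Prop :=
  exists (f : U -> V) (L C : R), 1 <= L /\ 0 <= C /\
    (forall x y, / L * gdist adjU x y - C <= gdist adjV (f x) (f y) /\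
                 gdist adjV (f x) (f y) <= L * gdist adjU x y + C) /\
    (forall v, exists x, gdist adjV v (f x) <= C).

Definition quasi_tree {U : Type} (adjU : U -> U -> Prop) : Prop :=
  gconnected adjU /\
  exists (V : Type) (adjV : V -> V -> Prop),
    simplicial_tree adjV /\ quasi_isometric_graphs adjU adjV.

(* Main.v *)
(* The tree. In a connected graph with a root, join x to a chosen vertex w one level closer
   to the root that can be joined to x without going below the level of w. This is a tree on
   the same vertex set, and the identity is a quasi-isometry as soon as two vertices of level
   n joined by a path of levels >= n are at bounded distance, which follows from a bottleneck
   property: x and z are joined by a path every vertex of which is near every path from x
   to z.

   The bottleneck. For K >= 8 xi, d_W(X,Y) <= d_W(X,Z) when Y is in Y_K(X,Z), so by induction
   Y_K(X,Z) together with X and Z contains a path from X to Z. Suppose that a path from X to Z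
   stays at distance > 2 from some A in Y_K(X,Z). Two consecutive vertices of it are then
   separated from A by a common element. The relation "B separates X from A" can be set up so
   that two separators of one element are equal or comparable; it is therefore confluent, so
   X and Z have a common lower bound D. Seen from A, both are close to D, and d_A(X,Z) is
   too small. *)

Require Import Defs.
From Stdlib Require Import Reals List Lia Lra Classical ClassicalEpsilon.
From Stdlib Require Import FunctionalExtensionality PropExtensionality Wf_nat Relations.
From Coquelicot Require Import Coquelicot.
Open Scope R_scope.

(** * Walks and distances in graphs *)

Section Walks.
Context {V : Type} (adj : V -> V -> Prop).

Lemma walk_adj (x y : V) : adj x y -> walk adj 1 x y.
Proof. intros H; apply walkS with y; [exact H | apply walk0]. Qed.

Lemma walk_app (n m : nat) (x y z : V) :
  walk adj n x y -> walk adj m y z -> walk adj (n + m) x z.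
Proof.
  intros H; revert z; induction H as [x | n x y w Hxy _ IH]; intros z Hz; simpl.
  - exact Hz.
  - apply walkS with y; auto.
Qed.

Lemma walk_sym (adj_sym : forall x y, adj x y -> adj y x) (n : nat) (x y : V) :
  walk adj n x y -> walk adj n y x.
Proof.
  intros H; induction H as [x | n x y z Hxy _ IH].
  - apply walk0.
  - replace (S n) with (n + 1)%nat by lia.
    apply walk_app with y; [exact IH | apply walk_adj; auto].
Qed.

Inductive joined (P : V -> Prop) : V -> V -> Prop :=
| joined_refl x : P x -> joined P x x
| joined_step x y z : P x -> adj x y -> joined P y z -> joined P x z.

Lemma joined_trans (P : V -> Prop) (x y z : V) :
  joined P x y -> joined P y z -> joined P x z.
Proof.
  intros H; revert z; induction H as [x Hx | x y w Hx Hxy _ IH]; intros z Hz.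
  - exact Hz.
  - apply joined_step with y; auto.
Qed.

Lemma joined_imp (P Q : V -> Prop) (x y : V) :
  (forall v, P v -> Q v) -> joined P x y -> joined Q x y.
Proof.
  intros HPQ H; induction H as [x Hx | x y w Hx Hxy _ IH].
  - apply joined_refl; auto.
  - apply joined_step with y; auto.
Qed.

Lemma joined_ends (P : V -> Prop) (x y : V) : joined P x y -> P x /\ P y.
Proof. intros H; induction H; tauto. Qed.

Lemma joined_sym (adj_sym : forall x y, adj x y -> adj y x) (P : V -> Prop) (x y : V) :
  joined P x y -> joined P y x.
Proof.
  intros H; induction H as [x Hx | x y z Hx Hxy Hyz IH].
  - apply joined_refl; auto.
  - apply joined_trans with y; [exact IH |].
    apply joined_step with x; auto.
    + apply (joined_ends P y z Hyz).
    + apply joined_refl; exact Hx.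
Qed.

Lemma joined_walk (P : V -> Prop) (x y : V) : joined P x y -> exists n, walk adj n x y.
Proof.
  intros H; induction H as [x Hx | x y z Hx Hxy _ [n Hn]].
  - exists 0%nat; apply walk0.
  - exists (S n); apply walkS with y; auto.
Qed.

(** The first vertex of the path outside [A] lies in [B], and its predecessor in [A]; [v = w] covers
    a path that never leaves [A]. *)
Lemma joined_crossing (P A B : V -> Prop) (x y : V) :
  (forall v, P v -> A v \/ B v) -> joined P x y -> A x -> B y ->
  exists v w, A v /\ B w /\ (v = w \/ adj v w).
Proof.
  intros HP H; induction H as [x Hx | x y z Hx Hxy Hyz IH]; intros Ax Bz.
  - exists x, x; auto.
  - destruct (HP y (proj1 (joined_ends _ _ _ Hyz))) as [Ay | By].
    + auto.
    + exists x, y; auto.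
Qed.

(** Values in [nat] keep the later estimates on levels within [lia]; [gdist_INR] links them to
    [gdist]. *)
Definition is_dist (d : V -> V -> nat) : Prop :=
  forall x y, walk adj (d x y) x y /\ forall n, walk adj n x y -> (d x y <= n)%nat.

Lemma dist_exists : gconnected adj -> exists d, is_dist d.
Proof.
  intros Hc.
  assert (Hex : forall x y, exists n, walk adj n x y /\
      forall m, walk adj m x y -> (n <= m)%nat).
  { intros x y.
    destruct (dec_inh_nat_subset_has_unique_least_element
                (fun n => walk adj n x y)) as [n [Hn _]]; [| apply Hc | exists n; exact Hn].
    intros n; apply classic. }
  exists (fun x y => proj1_sig (constructive_indefinite_description _ (Hex x y))).
  intros x y; destruct (constructive_indefinite_description _ (Hex x y)) as [n Hn]; exact Hn.
Qed.

Lemma gdist_INR (d : V -> V -> nat) (x y : V) :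
  is_dist d -> gdist adj x y = INR (d x y).
Proof.
  intros Hd; unfold gdist; destruct (Hd x y) as [Hw Hmin].
  rewrite (is_glb_Rbar_unique _ (Finite (INR (d x y)))); [reflexivity |].
  split.
  - intros r [n [Hn ->]]; apply le_INR; auto.
  - intros b Hb; apply Hb; exists (d x y); auto.
Qed.

End Walks.

Lemma walk_lipschitz {V : Type} (adj adj' : V -> V -> Prop) (L : nat) :
  (forall x y, adj x y -> exists m, (m <= L)%nat /\ walk adj' m x y) ->
  forall n x y, walk adj n x y -> exists m, (m <= L * n)%nat /\ walk adj' m x y.
Proof.
  intros Hadj n x y H; induction H as [x | n x y z Hxy _ [m [Hm Hw]]].
  - exists 0%nat; split; [lia | apply walk0].
  - destruct (Hadj x y Hxy) as [k [Hk Hk']].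
    exists (k + m)%nat; split; [lia | apply walk_app with y; auto].
Qed.

Lemma gdist_lipschitz {V : Type} (adj adj' : V -> V -> Prop) (L : nat) :
  gconnected adj -> gconnected adj' ->
  (forall x y, adj x y -> exists m, (m <= L)%nat /\ walk adj' m x y) ->
  forall x y, gdist adj' x y <= INR L * gdist adj x y.
Proof.
  intros Hc Hc' Hadj x y.
  destruct (dist_exists adj Hc) as [d Hd], (dist_exists adj' Hc') as [d' Hd'].
  rewrite (gdist_INR adj d x y Hd), (gdist_INR adj' d' x y Hd'), <- mult_INR.
  apply le_INR.
  destruct (walk_lipschitz adj adj' L Hadj _ x y (proj1 (Hd x y))) as [m [Hm Hw]].
  apply Nat.le_trans with m; [apply Hd'; exact Hw | exact Hm].
Qed.

(** * Trees given by a parent function *)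

Section ParentTree.
Context {V : Type} (root : V) (l : V -> nat) (p : V -> V).
Context (l_root : forall x, l x = 0%nat -> x = root).
Context (l_parent : forall x, (0 < l x)%nat -> S (l (p x)) = l x).

Definition parent_adj (x y : V) : Prop :=
  ((0 < l x)%nat /\ y = p x) \/ ((0 < l y)%nat /\ x = p y).

Lemma parent_adj_sym (x y : V) : parent_adj x y -> parent_adj y x.
Proof. unfold parent_adj; tauto. Qed.

Lemma walk_to_root (n : nat) (x : V) : l x = n -> walk parent_adj n x root.
Proof.
  revert x; induction n as [| n IH]; intros x Hx.
  - rewrite (l_root x Hx); apply walk0.
  - assert (Hp := l_parent x ltac:(lia)).
    apply walkS with (p x); [left; split; [lia | reflexivity] | apply IH; lia].
Qed.

Lemma parent_adj_connected : gconnected parent_adj.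
Proof.
  intros x y; exists (l x + l y)%nat; apply walk_app with root.
  - apply walk_to_root; reflexivity.
  - apply walk_sym; [exact parent_adj_sym | apply walk_to_root; reflexivity].
Qed.

(** After a step to a child the path must keep climbing: the only neighbour of lower level is the
    parent, which was just visited. *)
Lemma chain_ascending (t : list V) (a b : V) :
  chain parent_adj (a :: b :: t) -> NoDup (a :: b :: t) -> (0 < l b)%nat -> a = p b ->
  (l b <= l (last (b :: t) root))%nat.
Proof.
  revert a b; induction t as [| c t IH]; intros a b Hch Hnd Hb Ha; [simpl; lia |].
  destruct Hch as [_ [Hbc Hch]].
  assert (Hnd' : NoDup (b :: c :: t)) by (inversion Hnd; assumption).
  destruct Hbc as [[_ Hc] | [Hc Hbc]].
  - exfalso; inversion Hnd as [| ? ? Hin _]; apply Hin; right; left; congruence.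
  - assert (Hl := IH b c (conj (or_intror (conj Hc Hbc)) Hch) Hnd' Hc Hbc).
    assert (Hp := l_parent c Hc); rewrite <- Hbc in Hp.
    change (last (b :: c :: t) root) with (last (c :: t) root); lia.
Qed.

(** A path without repetition falls towards the root and then climbs. Either it only falls, or its
    last step starts at the parent of its last vertex. *)
Lemma chain_last (t : list V) (a b : V) :
  chain parent_adj (a :: b :: t) -> NoDup (a :: b :: t) ->
  (l (last (b :: t) root) < l a)%nat \/ In (p (last (b :: t) root)) (a :: b :: t).
Proof.
  revert a b; induction t as [| c t IH]; intros a b Hch Hnd.
  - destruct Hch as [[[Ha Hb] | [Hb Ha]] _]; simpl.
    + left; assert (Hp := l_parent a Ha); rewrite <- Hb in Hp; lia.
    + right; left; exact Ha.
  - assert (Hnd' : NoDup (b :: c :: t)) by (inversion Hnd; assumption).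
    assert (Hab := proj1 Hch).
    destruct (IH b c (proj2 Hch) Hnd') as [Hlt | Hin]; [| right; right; exact Hin].
    change (last (b :: c :: t) root) with (last (c :: t) root).
    destruct Hab as [[Ha Hb] | [Hb Ha]].
    + left; assert (Hp := l_parent a Ha); rewrite <- Hb in Hp; lia.
    + assert (Hl := chain_ascending (c :: t) a b Hch Hnd Hb Ha).
      change (last (b :: c :: t) root) with (last (c :: t) root) in Hl; lia.
Qed.

Lemma parent_adj_acyclic : ~ has_cycle parent_adj.
Proof.
  intros [[| a [| b [| c t]]] [x0 [Hlen [Hnd [Hch Hcl]]]]]; try (simpl in Hlen; lia).
  (* The list is nonempty, so the default of [last] can be changed to [root], the one in the lemmas
     on chains. *)
  assert (Hlast : last (a :: b :: c :: t) x0 = last (c :: t) root).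
  { change (last (a :: b :: c :: t) x0) with (last (c :: t) x0).
    clear; revert c; induction t as [| d t IH]; intros c; [reflexivity |].
    change (last (d :: t) x0 = last (d :: t) root); apply IH. }
  rewrite Hlast in Hcl; simpl hd in Hcl.
  set (m := last (c :: t) root) in *.
  assert (Hm : In m (c :: t)).
  { unfold m; clear; revert c; induction t as [| d t IH]; intros c; [left; reflexivity |].
    right; change (In (last (d :: t) root) (d :: t)); apply IH. }
  assert (Hnd' : NoDup (b :: c :: t)) by (inversion Hnd; assumption).
  assert (Hab := proj1 Hch).
  assert (Hup : (0 < l b)%nat -> a = p b -> (l b <= l m)%nat).
  { intros Hb Ha; exact (chain_ascending (c :: t) a b Hch Hnd Hb Ha). }
  (* Either [a] is the parent of [m] or [m] that of [a]. Levels exclude all but two cases: [a]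
     recurs in the tail, or [b] and [m] are both the parent of [a]. *)
  destruct Hcl as [[H0 Ha] | [H0 Hma]].
  - assert (Hpm := l_parent m H0); rewrite <- Ha in Hpm.
    destruct (chain_last t b c (proj2 Hch) Hnd') as [Hlt | Hin].
    + fold m in Hlt; destruct Hab as [[Ha0 Hb] | [Hb Hab]].
      * assert (Hp := l_parent a Ha0); rewrite <- Hb in Hp; lia.
      * specialize (Hup Hb Hab); lia.
    + fold m in Hin; rewrite <- Ha in Hin.
      inversion Hnd; contradiction.
  - assert (Hp := l_parent a H0); rewrite <- Hma in Hp.
    destruct Hab as [[_ Hb] | [Hb Hab]].
    + inversion Hnd' as [| ? ? Hin _]; apply Hin; congruence.
    + specialize (Hup Hb Hab).
      assert (Hp' := l_parent b Hb); rewrite <- Hab in Hp'; lia.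
Qed.

Lemma parent_adj_tree : simplicial_tree parent_adj.
Proof.
  split; [exact parent_adj_sym |].
  split; [| split; [exact parent_adj_connected | exact parent_adj_acyclic]].
  intros x [[H Hx] | [H Hx]]; assert (Hp := l_parent x H); rewrite <- Hx in Hp; lia.
Qed.

End ParentTree.

(** * Graphs with the bottleneck property *)

(** A variant of Manning's bottleneck property: in place of the midpoint of a geodesic, all vertices
    of a set [P] containing a path have to be near every path. *)
Definition bottleneck {V : Type} (adj : V -> V -> Prop) (N : nat) : Prop :=
  forall x z, exists P : V -> Prop, joined adj P x z /\
    forall y, P y -> forall Q, joined adj Q x z ->
      exists q n, Q q /\ (n <= N)%nat /\ walk adj n q y.

Section Bottleneck.
Context {V : Type} (adj : V -> V -> Prop) (N : nat).
Context (adj_sym : forall x y, adj x y -> adj y x).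
Context (Hbot : bottleneck adj N).
Context (d : V -> V -> nat) (Hd : is_dist adj d) (root : V).

Lemma dist_le (n : nat) (x y : V) : walk adj n x y -> (d x y <= n)%nat.
Proof. apply Hd. Qed.

Lemma dist_triangle (x y z : V) : (d x z <= d x y + d y z)%nat.
Proof. apply dist_le, walk_app with y; apply Hd. Qed.

Lemma dist_sym (x y : V) : d x y = d y x.
Proof.
  apply Nat.le_antisymm; apply dist_le, walk_sym; try apply Hd; exact adj_sym.
Qed.

Lemma dist_refl (x : V) : d x x = 0%nat.
Proof. assert (H := dist_le _ _ _ (walk0 adj x)); lia. Qed.

Lemma geodesic_joined (x y : V) :
  joined adj (fun v => (d x v + d v y = d x y)%nat) x y.
Proof.
  remember (d x y) as n eqn:Hn; revert x Hn.
  induction n as [| n IH]; intros x Hn.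
  - assert (Hw := proj1 (Hd x y)); rewrite <- Hn in Hw; inversion Hw; subst.
    apply joined_refl; lia.
  - assert (Hw := proj1 (Hd x y)); rewrite <- Hn in Hw.
    inversion Hw as [| n' x' w y' Hxw Hwy]; subst.
    assert (H1 := dist_le _ _ _ (walk_adj adj _ _ Hxw)).
    assert (H2 := dist_le _ _ _ Hwy).
    assert (H3 := dist_triangle x w y).
    assert (H0 := dist_refl x).
    apply joined_step with w; [lia | exact Hxw |].
    apply joined_imp with (fun v => (d w v + d v y = n)%nat); [| apply IH; lia].
    intros v Hv.
    assert (H4 := dist_triangle x w v); assert (H5 := dist_triangle x v y); lia.
Qed.

Local Notation lev := (d root).

(** Both vertices lie on one sphere about the root and in one component of the subgraph on and
    outside that sphere. *)
Definition same_end (x y : V) : Prop :=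
  lev x = lev y /\ joined adj (fun v => (lev x <= lev v)%nat) x y.

Lemma same_end_sym (x y : V) : same_end x y -> same_end y x.
Proof.
  intros [Hl Hj]; split; [congruence |].
  rewrite <- Hl; apply joined_sym; assumption.
Qed.

(* A bottleneck point lies near the high path joining x and y, so its level is not much
   below that of x and y; it also lies near a geodesic through the root, and the points of
   that geodesic of such a level are near x or y. *)
Lemma same_end_dist (x y : V) : same_end x y -> (d x y <= 6 * N + 1)%nat.
Proof.
  intros [Hl Hj].
  destruct (Hbot x y) as [P [HP Hnear]].
  (* For [3 * N]: [v] has level at least [lev x - N], so [u] has level at least [lev x - 2 * N] and
     lies within [2 * N] of [x] or [y]; from [u] to [v] it is [N] more. *)
  destruct (joined_crossing adj P (fun v => (d v x <= 3 * N)%nat)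
              (fun v => (d v y <= 3 * N)%nat) x y) as [v [w [Hv [Hw Hvw]]]].
  - intros v Pv.
    destruct (Hnear v Pv _ Hj) as [q [n [Hq [Hn Hqv]]]].
    assert (Hqv' := dist_le _ _ _ Hqv).
    assert (T1 := dist_triangle root v q); rewrite (dist_sym v q) in T1.
    destruct (Hnear v Pv
        (fun u => (d x u + lev u = lev x)%nat \/ (d y u + lev u = lev y)%nat))
      as [u [k [Hu [Hk Huv]]]].
    + apply joined_trans with root.
      * apply joined_imp with (2 := geodesic_joined x root); intros u Hu; left.
        rewrite (dist_sym u root), (dist_sym x root) in Hu; exact Hu.
      * apply joined_imp with (2 := geodesic_joined root y); intros u Hu; right.
        rewrite (dist_sym u y) in Hu; lia.
    + assert (Huv' := dist_le _ _ _ Huv).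
      assert (T2 := dist_triangle root u v).
      assert (T3 := dist_triangle v u x); assert (T4 := dist_triangle v u y).
      rewrite (dist_sym v u) in T3, T4.
      rewrite (dist_sym u x) in T3; rewrite (dist_sym u y) in T4.
      destruct Hu as [Hu | Hu]; [left | right]; lia.
  - exact HP.
  - rewrite dist_refl; lia.
  - rewrite dist_refl; lia.
  - assert (Hvw' : (d v w <= 1)%nat).
    { destruct Hvw as [-> | Hvw]; [rewrite dist_refl; lia |].
      apply dist_le, walk_adj; exact Hvw. }
    assert (T1 := dist_triangle x v y); assert (T2 := dist_triangle v w y).
    rewrite (dist_sym x v) in T1; lia.
Qed.

(** A high path in place of an edge gives all vertices of a [same_end] class the same candidates. *)
Definition precedes (x w : V) : Prop :=
  S (lev w) = lev x /\ joined adj (fun v => (lev w <= lev v)%nat) w x.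

(* Being chosen by [epsilon], the parent is the same for all vertices with the same
   predecessors. *)
Definition parent (x : V) : V := epsilon (inhabits root) (precedes x).

Lemma precedes_exists (x : V) :
  (0 < lev x)%nat -> exists w, precedes x w /\ adj w x.
Proof.
  intros Hx; assert (Hw := proj1 (Hd x root)); rewrite dist_sym in Hw.
  inversion Hw as [? Heq | n x' w y' Hxw Hwr Heq]; subst; [lia |].
  assert (H1 := dist_le _ _ _ Hwr); rewrite dist_sym in H1.
  assert (H2 := dist_triangle root w x).
  assert (H3 := dist_le _ _ _ (walk_adj adj _ _ (adj_sym _ _ Hxw))).
  exists w; split; [split; [lia |] | auto].
  apply joined_step with x; [lia | auto | apply joined_refl; lia].
Qed.

Lemma precedes_parent (x : V) : (0 < lev x)%nat -> precedes x (parent x).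
Proof.
  intros Hx; unfold parent; apply epsilon_spec.
  destruct (precedes_exists x Hx) as [w [Hw _]]; exists w; exact Hw.
Qed.

Lemma precedes_same_end (x w w' : V) : precedes x w -> precedes x w' -> same_end w w'.
Proof.
  intros [Hl Hj] [Hl' Hj']; assert (Hww : lev w = lev w') by lia.
  split; [exact Hww |].
  apply joined_trans with x; [exact Hj |].
  apply joined_sym; [exact adj_sym | rewrite Hww; exact Hj'].
Qed.

Lemma parent_same_end (x y : V) : same_end x y -> parent x = parent y.
Proof.
  assert (Himp : forall a b w, same_end a b -> precedes a w -> precedes b w).
  { intros a b w [Hl Hj] [Hl' Hj']; split; [congruence |].
    apply joined_trans with a; [exact Hj' |].
    apply joined_imp with (2 := Hj); intros; lia. }
  intros Hxy; unfold parent; f_equal; apply functional_extensionality; intros w.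
  apply propositional_extensionality; split; apply Himp;
    [exact Hxy | apply same_end_sym; exact Hxy].
Qed.

Lemma lev_root (x : V) : lev x = 0%nat -> x = root.
Proof.
  intros Hx; assert (Hw := proj1 (Hd root x)); rewrite Hx in Hw.
  inversion Hw; reflexivity.
Qed.

Lemma lev_parent (x : V) : (0 < lev x)%nat -> S (lev (parent x)) = lev x.
Proof. intros Hx; apply (precedes_parent x Hx). Qed.

Local Notation tree_adj := (parent_adj lev parent).

Lemma same_end_tree_walk (x y : V) :
  same_end x y -> exists m, (m <= 2)%nat /\ walk tree_adj m x y.
Proof.
  intros Hxy; destruct (Nat.eq_dec (lev x) 0) as [H0 | H0].
  - exists 0%nat; split; [lia |].
    rewrite (lev_root x H0), (lev_root y); [apply walk0 |].
    rewrite <- (proj1 Hxy); exact H0.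
  - exists 2%nat; split; [lia |].
    assert (Hl := proj1 Hxy).
    apply walkS with (parent x); [left; split; [lia | reflexivity] |].
    apply walk_adj; right; split; [lia | apply parent_same_end; exact Hxy].
Qed.

Lemma adj_tree_walk (x y : V) :
  adj x y -> exists m, (m <= 3)%nat /\ walk tree_adj m x y.
Proof.
  (* [a] is itself a candidate for the parent of [b], hence within tree distance 2 of [parent b];
     the edge from [b] to [parent b] makes 3. *)
  assert (Hup : forall a b, adj a b -> lev b = S (lev a) ->
    exists m, (m <= 3)%nat /\ walk tree_adj m b a).
  { intros a b Hab Hl.
    destruct (same_end_tree_walk (parent b) a) as [m [Hm Hw]].
    - apply precedes_same_end with b; [apply precedes_parent; lia |].
      split; [congruence |].
      apply joined_step with b; [lia | exact Hab | apply joined_refl; lia].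
    - exists (S m); split; [lia |].
      apply walkS with (parent b); [left; split; [lia | reflexivity] | exact Hw]. }
  intros Hxy.
  assert (H1 := dist_le _ _ _ (walk_adj adj _ _ Hxy)).
  assert (H2 := dist_triangle root x y); assert (H3 := dist_triangle root y x).
  rewrite (dist_sym y x) in H3.
  assert (Hc : lev x = lev y \/ lev y = S (lev x) \/ lev x = S (lev y)) by lia.
  destruct Hc as [Hl | [Hl | Hl]].
  - destruct (same_end_tree_walk x y) as [m [Hm Hw]].
    + split; [exact Hl |].
      apply joined_step with y; [lia | exact Hxy | apply joined_refl; lia].
    + exists m; split; [lia | exact Hw].
  - destruct (Hup x y Hxy Hl) as [m [Hm Hw]].
    exists m; split; [exact Hm |].
    apply walk_sym; [apply parent_adj_sym | exact Hw].
  - exact (Hup y x (adj_sym _ _ Hxy) Hl).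
Qed.

(** One edge leads to an adjacent candidate, and [same_end_dist] bounds the way from there to the
    chosen parent by [6 * N + 1]. *)
Lemma tree_adj_walk (x y : V) :
  tree_adj x y -> exists m, (m <= 6 * N + 2)%nat /\ walk adj m x y.
Proof.
  assert (Hp : forall a, (0 < lev a)%nat -> (d a (parent a) <= 6 * N + 2)%nat).
  { intros a Ha; destruct (precedes_exists a Ha) as [w [Hw Hwa]].
    assert (H1 := same_end_dist w (parent a)
                    (precedes_same_end a _ _ Hw (precedes_parent a Ha))).
    assert (H2 := dist_le _ _ _ (walk_adj adj _ _ (adj_sym _ _ Hwa))).
    assert (H3 := dist_triangle a w (parent a)); lia. }
  intros Hxy; exists (d x y); split; [| apply Hd].
  destruct Hxy as [[Hx ->] | [Hy ->]]; [| rewrite dist_sym]; apply Hp; assumption.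
Qed.

End Bottleneck.

Lemma quasi_tree_of_bottleneck {V : Type} (adj : V -> V -> Prop) (N : nat) :
  (forall x y, adj x y -> adj y x) -> bottleneck adj N -> quasi_tree adj.
Proof.
  intros Hsym Hbot.
  assert (Hc : gconnected adj).
  { intros x y; destruct (Hbot x y) as [P [HP _]]; exact (joined_walk adj P x y HP). }
  split; [exact Hc |].
  destruct (classic (inhabited V)) as [[root] | Hempty].
  - destruct (dist_exists adj Hc) as [d Hd].
    pose (tadj := parent_adj (d root) (parent adj d root)).
    assert (Htree : simplicial_tree tadj).
    { apply (parent_adj_tree root).
      - exact (lev_root adj d Hd root).
      - exact (lev_parent adj Hsym d Hd root). }
    assert (Hc' := proj1 (proj2 (proj2 Htree))).
    exists V, tadj; split; [exact Htree |].
    (* [6 * N + 3] bounds both Lipschitz constants of the identity, [6 * N + 2] and [3]. *)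
    assert (HN : 1 <= INR (6 * N + 3)).
    { change 1 with (INR 1); apply le_INR; lia. }
    exists (fun x => x), (INR (6 * N + 3)), 0; split; [exact HN |]; split; [lra |].
    split; [intros x y; split |].
    + assert (H := gdist_lipschitz tadj adj (6 * N + 3) Hc' Hc).
      assert (Hle : gdist adj x y <= INR (6 * N + 3) * gdist tadj x y).
      { apply H; intros a b Hab.
        destruct (tree_adj_walk adj N Hsym Hbot d Hd root a b Hab) as [m [Hm Hw]].
        exists m; split; [lia | exact Hw]. }
      apply Rmult_le_compat_l with (r := / INR (6 * N + 3)) in Hle;
        [| left; apply Rinv_0_lt_compat; lra].
      rewrite <- Rmult_assoc, Rinv_l, Rmult_1_l in Hle; lra.
    + rewrite Rplus_0_r; apply gdist_lipschitz; auto.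
      intros a b Hab.
      destruct (adj_tree_walk adj Hsym d Hd root a b Hab) as [m [Hm Hw]].
      exists m; split; [lia | exact Hw].
    + intros v; exists v; destruct (dist_exists tadj Hc') as [d' Hd'].
      rewrite (gdist_INR tadj d' v v Hd').
      assert (H0 := proj2 (Hd' v v) _ (walk0 tadj v)).
      apply le_INR in H0; exact H0.
  - assert (Hno : forall v : V, False) by (intros v; apply Hempty, inhabits, v).
    exists V, adj; split.
    + split; [exact Hsym |]; split; [intros x; contradiction (Hno x) |].
      split; [exact Hc | intros [l [x0 _]]; exact (Hno x0)].
    + exists (fun x => x), 1, 0; split; [lra |]; split; [lra |]; split.
      * intros x; contradiction (Hno x).
      * intros v; contradiction (Hno v).
Qed.

(** * Projection complexes *)

Section Projections.
Context {T : Type} (dpi : T -> T -> T -> R) (xi : R).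
Context (Hax : projection_axioms dpi xi).

Lemma xi_pos : 0 < xi.
Proof. apply Hax. Qed.

Lemma dpi_sym (Y X Z : T) : X <> Y -> Z <> Y -> dpi Y X Z = dpi Y Z X.
Proof. apply Hax. Qed.

Lemma dpi_triangle (Y X Z W : T) :
  X <> Y -> Z <> Y -> W <> Y -> dpi Y X W <= dpi Y X Z + dpi Y Z W.
Proof.
  destruct Hax as (_ & _ & _ & H & _); intros HX HZ HW; specialize (H Y X Z W HX HZ HW); lra.
Qed.

(** Axiom (3), the Behrstock inequality, read as an implication. *)
Lemma behrstock (X Y Z : T) :
  X <> Y -> Y <> Z -> X <> Z -> xi <= dpi Y X Z -> dpi X Y Z < xi.
Proof.
  destruct Hax as (_ & _ & _ & _ & H & _); intros HXY HYZ HXZ Hle.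
  assert (Hmin := H Z Y X ltac:(auto) ltac:(auto) ltac:(auto)).
  rewrite (dpi_sym Y Z X), (dpi_sym X Z Y) in Hmin by auto.
  unfold Rmin in Hmin; destruct (Rle_dec _ _) in Hmin; lra.
Qed.

Lemma Hpair_sym (X Z X' Z' : T) : Hpair dpi xi X Z X' Z' -> Hpair dpi xi Z X Z' X'.
Proof.
  intros [(H1 & H2 & H3 & H4 & H5 & H6) | [(-> & H1 & H2 & H3) | [(-> & H1 & H2 & H3) | [-> ->]]]].
  - left; rewrite (dpi_sym Z), (dpi_sym X) by auto; auto 7.
  - right; right; left; rewrite (dpi_sym Z) by auto; auto.
  - right; left; rewrite (dpi_sym X) by auto; auto.
  - right; right; right; auto.
Qed.

(** Seen from [X], one of [X'], [Z'] is far from [Y], hence near [X] seen from [Y]. In the same way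
    one is near [Z], and it is the other one since [dpi Y X Z] is large. So [dpi Y X' Z'] still
    exceeds [2 * xi]. *)
Lemma Hpair_between (X Y Z X' Z' : T) :
  X <> Y -> Y <> Z -> X <> Z -> 4 * xi < dpi Y X Z ->
  Hpair dpi xi X Z X' Z' -> Hpair dpi xi X Y X' Z'.
Proof.
  intros HXY HYZ HXZ Hlt; assert (Hxi := xi_pos).
  assert (HX := behrstock X Y Z HXY HYZ HXZ ltac:(lra)).
  assert (HZ := behrstock Z Y X ltac:(auto) ltac:(auto) ltac:(auto)
                  ltac:(rewrite (dpi_sym Y) by auto; lra)).
  assert (HZs := dpi_sym Z X Y ltac:(auto) ltac:(auto)).
  assert (HXs := dpi_sym X Z Y ltac:(auto) ltac:(auto)).
  assert (fromX : forall W, W <> X -> xi <= dpi X W Y -> W <> Y -> dpi Y W X < xi).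
  { intros W HW Hle HWY; rewrite dpi_sym by auto.
    apply behrstock; auto; rewrite dpi_sym by auto; exact Hle. }
  assert (fromZ : forall W, W <> Z -> xi <= dpi Z W Y -> W <> Y -> dpi Y W Z < xi).
  { intros W HW Hle HWY; rewrite dpi_sym by auto.
    apply behrstock; auto; rewrite dpi_sym by auto; exact Hle. }
  assert (notboth : forall W, W <> X -> W <> Z ->
            xi <= dpi X W Y -> xi <= dpi Z W Y -> W = Y).
  { intros W HWX HWZ H1 H2; apply NNPP; intros HWY.
    specialize (fromX W HWX H1 HWY); specialize (fromZ W HWZ H2 HWY).
    assert (t := dpi_triangle Y X W Z ltac:(auto) ltac:(auto) ltac:(auto)).
    rewrite (dpi_sym Y X W) in t by auto; lra. }
  (* The axioms do not make [dpi X Y Y] zero; a detour through [Z] bounds it. *)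
  assert (notY : dpi X Y Y < 2 * xi).
  { assert (t := dpi_triangle X Y Z Y ltac:(auto) ltac:(auto) ltac:(auto)); lra. }
  intros [(H1 & H2 & H3 & H4 & H5 & H6) | [(-> & _ & H1 & H2) | [(-> & H1 & _ & H2) | [-> ->]]]].
  - assert (HX'Y : X' <> Y).
    { intros ->; assert (Z' = Y); [| subst; lra].
      rewrite (dpi_sym X) in H5 by auto; rewrite (dpi_sym Z) in H6 by auto.
      apply notboth; auto; lra. }
    assert (HZ'Y : Z' <> Y) by (intros ->; apply HX'Y, notboth; auto; lra).
    assert (t1 := dpi_triangle X X' Y Z' ltac:(auto) ltac:(auto) ltac:(auto)).
    assert (t2 := dpi_triangle Z X' Y Z' ltac:(auto) ltac:(auto) ltac:(auto)).
    rewrite (dpi_sym X Y Z') in t1 by auto; rewrite (dpi_sym Z Y Z') in t2 by auto.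
    left; repeat split; auto.
    destruct (Rle_dec xi (dpi X X' Y)) as [c1 | c1], (Rle_dec xi (dpi Z X' Y)) as [c2 | c2].
    + exfalso; apply HX'Y, notboth; auto.
    + assert (n1 := fromX X' ltac:(auto) c1 HX'Y).
      assert (n2 := fromZ Z' ltac:(auto) ltac:(lra) HZ'Y).
      assert (t3 := dpi_triangle Y X X' Z ltac:(auto) ltac:(auto) ltac:(auto)).
      assert (t4 := dpi_triangle Y X' Z' Z ltac:(auto) ltac:(auto) ltac:(auto)).
      rewrite (dpi_sym Y X X') in t3 by auto; lra.
    + assert (n1 := fromZ X' ltac:(auto) c2 HX'Y).
      assert (n2 := fromX Z' ltac:(auto) ltac:(lra) HZ'Y).
      assert (t3 := dpi_triangle Y X Z' Z ltac:(auto) ltac:(auto) ltac:(auto)).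
      assert (t4 := dpi_triangle Y Z' X' Z ltac:(auto) ltac:(auto) ltac:(auto)).
      rewrite (dpi_sym Y X Z'), (dpi_sym Y Z' X') in * by auto; lra.
    + exfalso; apply HZ'Y, notboth; auto; lra.
  - assert (HZ'Y : Z' <> Y) by (intros ->; lra).
    assert (t1 := dpi_triangle Z X Y Z' ltac:(auto) ltac:(auto) ltac:(auto)).
    rewrite (dpi_sym Z Y Z') in t1 by auto.
    assert (n := fromZ Z' ltac:(auto) ltac:(lra) HZ'Y).
    assert (t2 := dpi_triangle Y X Z' Z ltac:(auto) ltac:(auto) ltac:(auto)).
    right; left; repeat split; auto; lra.
  - assert (HX'Y : X' <> Y) by (intros ->; lra).
    assert (t1 := dpi_triangle X X' Y Z ltac:(auto) ltac:(auto) ltac:(auto)).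
    assert (n := fromX X' ltac:(auto) ltac:(lra) HX'Y).
    assert (t2 := dpi_triangle Y X X' Z ltac:(auto) ltac:(auto) ltac:(auto)).
    rewrite (dpi_sym Y X X') in t2 by auto.
    left; repeat split; auto; lra.
  - right; left; repeat split; auto; lra.
Qed.

Lemma dmod_sym (Y X Z : T) : dmod dpi xi Y X Z = dmod dpi xi Y Z X.
Proof.
  apply Glb_Rbar_eqset; intros r; split;
    intros (X' & Z' & H & HX & HZ & ->); exists Z', X';
    (split; [apply Hpair_sym, H | auto using dpi_sym]).
Qed.

Lemma inYK_sym (K : R) (X Z Y : T) : inYK dpi xi K X Z Y -> inYK dpi xi K Z X Y.
Proof. unfold inYK; rewrite (dmod_sym Y X Z); tauto. Qed.

Lemma PK_adj_sym (K : R) (X Z : T) : PK_adj dpi xi K X Z -> PK_adj dpi xi K Z X.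
Proof.
  intros [Hne H]; split; [auto |].
  intros Y HY; apply (H Y), inYK_sym, HY.
Qed.

Lemma inYK_lt_dpi (K : R) (X Z Y : T) : inYK dpi xi K X Z Y -> K < dpi Y X Z.
Proof.
  intros (HX & HZ & Hlt); apply (Rbar_lt_le_trans K (dmod dpi xi Y X Z) (dpi Y X Z) Hlt).
  apply Glb_Rbar_correct; exists X, Z; split; [right; right; right; auto | auto].
Qed.

Lemma inYK_mono (K : R) (X Y Z W : T) :
  X <> Y -> Y <> Z -> X <> Z -> 4 * xi < dpi Y X Z -> W <> Z ->
  inYK dpi xi K X Y W -> inYK dpi xi K X Z W.
Proof.
  intros HXY HYZ HXZ Hlt HWZ (HWX & HWY & HK); split; [exact HWX | split; [exact HWZ |]].
  apply Rbar_lt_le_trans with (1 := HK), Glb_Rbar_correct.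
  intros r (X' & Z' & H & HX & HZ & ->).
  apply Glb_Rbar_correct; exists X', Z'; split; [| auto].
  apply Hpair_between with Z; assumption.
Qed.

Lemma not_adj_inYK (K : R) (X Z : T) :
  X <> Z -> ~ PK_adj dpi xi K X Z -> exists Y, inYK dpi xi K X Z Y.
Proof.
  intros HXZ H; apply NNPP; intros Hno; apply H; split; [exact HXZ |].
  intros Y HY; apply Hno; exists Y; exact HY.
Qed.

(** * Paths in the complex for [K >= 8 * xi] *)

Section LargeK.
Context (K : R) (HK : 8 * xi <= K).

Local Notation adj := (PK_adj dpi xi K).
Local Notation YK := (inYK dpi xi K).

Lemma YK_sub (X Y Z W : T) : X <> Z -> YK X Z Y -> YK X Y W -> YK X Z W.
Proof.
  intros HXZ HY HW; assert (Hxi := xi_pos).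
  assert (H1 := inYK_lt_dpi _ _ _ _ HY); assert (H2 := inYK_lt_dpi _ _ _ _ HW).
  destruct HY as (HYX & HYZ & _).
  apply inYK_mono with Y; auto; [lra |].
  (* [W = Z] is impossible: [dpi Z X Y] and [dpi Y X Z] would both exceed [K]. *)
  intros ->; assert (H := behrstock Z Y X ltac:(auto) ltac:(auto) ltac:(auto)).
  rewrite (dpi_sym Y Z X), (dpi_sym Z Y X) in H by auto; lra.
Qed.

(** Axiom (4) gives a finite list covering [YK X Z], and the induction is on its length: for [Y] in
    [YK X Z], the sets [YK X Y] and [YK Y Z] lie in [YK X Z] and omit [Y], so the list without [Y]
    serves both. *)
Lemma YK_joined (X Z : T) :
  X <> Z -> joined adj (fun v => v = X \/ v = Z \/ YK X Z v) X Z.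
Proof.
  intros HXZ; assert (Hxi := xi_pos).
  assert (Hfin : exists l, forall Y, YK X Z Y -> In Y l).
  { destruct Hax as (_ & _ & _ & _ & _ & H); destruct (H X Z) as [l Hl].
    exists l; intros Y HY; assert (H1 := inYK_lt_dpi _ _ _ _ HY).
    destruct HY as (HYX & HYZ & _); apply Hl; auto; lra. }
  destruct Hfin as [l Hl]; remember (length l) as n eqn:Hn.
  assert (Hle : (length l <= n)%nat) by lia; clear Hn; revert X Z HXZ l Hl Hle.
  induction n as [n IH] using (well_founded_induction lt_wf); intros X Z HXZ l Hl Hle.
  destruct (classic (adj X Z)) as [Hadj | Hadj].
  { apply joined_step with Z; auto; apply joined_refl; auto. }
  destruct (not_adj_inYK K X Z HXZ Hadj) as [Y HY].
  assert (HYX : Y <> X) by apply HY; assert (HYZ : Y <> Z) by apply HY.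
  assert (HXsub : forall W, YK X Y W -> YK X Z W) by (intros W; apply YK_sub; auto).
  assert (HZsub : forall W, YK Y Z W -> YK X Z W).
  { intros W HW; apply inYK_sym, YK_sub with Y; auto; apply inYK_sym; assumption. }
  destruct (in_split Y l (Hl Y HY)) as (l1 & l2 & ->).
  rewrite length_app in Hle; simpl in Hle.
  assert (Hdel : forall W, YK X Z W -> W <> Y -> In W (l1 ++ l2)).
  { intros W HW HWY; assert (Hin := Hl W HW).
    rewrite in_app_iff in *; destruct Hin as [H | [H | H]]; auto; congruence. }
  apply joined_trans with Y.
  - apply joined_imp with (fun v => v = X \/ v = Y \/ YK X Y v).
    + intros v [-> | [-> | Hv]]; auto.
    + apply (IH (length (l1 ++ l2)) ltac:(rewrite length_app; lia)) with (l := l1 ++ l2);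
        [auto | | lia].
      intros W HW; apply Hdel; [auto | apply HW].
  - apply joined_imp with (fun v => v = Y \/ v = Z \/ YK Y Z v).
    + intros v [-> | [-> | Hv]]; auto.
    + apply (IH (length (l1 ++ l2)) ltac:(rewrite length_app; lia)) with (l := l1 ++ l2);
        [auto | | lia].
      intros W HW; apply Hdel; [auto | apply HW].
Qed.

(** Some [B] lies in [YK A X]; if [dpi A X X'] were larger, monotonicity would put [B] into
    [YK X X'], against adjacency. *)
Lemma adj_far_small (A X X' : T) :
  X <> A -> X' <> A -> ~ adj A X -> adj X X' -> dpi A X X' <= 4 * xi.
Proof.
  intros HX HX' Hna Hadj; assert (Hxi := xi_pos).
  destruct (not_adj_inYK K A X ltac:(auto) Hna) as [B HB].
  apply Rnot_lt_le; intros Hlt; apply (proj2 Hadj B).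
  assert (HXX' := proj1 Hadj).
  apply inYK_mono with A; auto; [| apply inYK_sym, HB].
  intros ->; assert (H := inYK_lt_dpi _ _ _ _ HB).
  assert (H' := behrstock X' A X ltac:(auto) ltac:(auto) ltac:(auto)).
  rewrite (dpi_sym A X' X) in H' by auto; lra.
Qed.

(** * Separation from a fixed vertex [A] *)

Section Barrier.
Context (A : T).

(* Measuring at a point [X'] beyond [X] makes two separators of the same [X] comparable with
   no loss in the constants; with the bare condition [4 * xi < dpi B A X] the error would
   accumulate along a path. *)
Definition separates (B X : T) : Prop :=
  B <> A /\ X <> A /\ B <> X /\ xi <= dpi B A X /\
  exists X', X' <> A /\ X' <> B /\ (X' = X \/ X' <> X /\ 2 * xi < dpi X A X') /\
             4 * xi < dpi B A X'.

(** Seen from [X], [B] is near [A] and so far from [X']; the Behrstock inequality then makes [X] and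
    [X'] close seen from [B]. *)
Lemma beyond_close (B X X' : T) :
  B <> A -> X <> A -> X' <> A -> B <> X -> xi <= dpi B A X ->
  X' <> X -> 2 * xi < dpi X A X' -> X' <> B /\ dpi B X X' < xi.
Proof.
  intros HBA HXA HX'A HBX Hle HX'X Hlt; assert (Hxi := xi_pos).
  assert (H1 := behrstock X B A ltac:(auto) ltac:(auto) ltac:(auto)
                  ltac:(rewrite (dpi_sym B) by auto; exact Hle)).
  rewrite (dpi_sym X) in H1 by auto.
  assert (HX'B : X' <> B) by (intros ->; lra).
  split; [exact HX'B |].
  apply behrstock; auto.
  assert (t := dpi_triangle X A B X' ltac:(auto) ltac:(auto) ltac:(auto)); lra.
Qed.

Lemma separates_large (B X : T) : separates B X -> 3 * xi < dpi B A X.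
Proof.
  intros (HBA & HXA & HBX & Hle & X' & HX'A & HX'B & [-> | [HX'X Hfar]] & Hlt);
    assert (Hxi := xi_pos); [lra |].
  destruct (beyond_close B X X' HBA HXA HX'A HBX Hle HX'X Hfar) as [_ Hc].
  assert (t := dpi_triangle B A X X' ltac:(auto) ltac:(auto) ltac:(auto)); lra.
Qed.

(** By the Behrstock inequality one of the two looks close to [A] from the other, and it separates
    the other from [A]. The witness [X'] is passed on unchanged, which preserves the bound
    [4 * xi]. *)
Lemma separates_comparable (B B' X : T) :
  separates B X -> separates B' X -> B = B' \/ separates B B' \/ separates B' B.
Proof.
  assert (Hxi := xi_pos).
  assert (Hwlog : forall C C', separates C X -> separates C' X -> C <> C' ->
            dpi C' A C < xi -> separates C C').
  { intros C C' HC HC' Hne Hnear.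
    assert (L := separates_large C X HC); assert (L' := separates_large C' X HC').
    destruct HC as (HCA & HXA & HCX & Hle & X' & HX'A & HX'C & HX' & Hlt).
    destruct HC' as (HC'A & _ & HC'X & Hle' & _).
    assert (t1 := dpi_triangle C' A C X ltac:(auto) ltac:(auto) ltac:(auto)).
    assert (n1 := behrstock C C' X ltac:(auto) ltac:(auto) ltac:(auto) ltac:(lra)).
    assert (t2 := dpi_triangle C A C' X ltac:(auto) ltac:(auto) ltac:(auto)).
    assert (Hfar : X' <> C' /\ 2 * xi < dpi C' A X').
    { destruct HX' as [-> | [HX'X Hfar]]; [split; [auto | lra] |].
      destruct (beyond_close C' X X') as [HX'C' Hc]; auto.
      split; [exact HX'C' |].
      assert (t3 := dpi_triangle C' A X' X ltac:(auto) ltac:(auto) ltac:(auto)).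
      rewrite (dpi_sym C' X' X) in t3 by auto; lra. }
    split; [exact HCA | split; [exact HC'A | split; [exact Hne | split; [lra |]]]].
    exists X'; split; [exact HX'A | split; [exact HX'C | split; [right; exact Hfar | exact Hlt]]]. }
  intros HB HB'; destruct (classic (B = B')) as [Heq | Hne]; [left; exact Heq | right].
  destruct (Rlt_dec (dpi B' A B) xi) as [Hlt | Hge]; [left; auto | right].
  apply Hwlog; auto.
  assert (HBA := proj1 HB); assert (HB'A := proj1 HB').
  rewrite dpi_sym by auto; apply behrstock; auto.
  rewrite dpi_sym by auto; lra.
Qed.

(** The bound does not decay with the length: each link starts afresh with [3 * xi] from
    [separates_large], and [C] and [X] differ by less than [xi] seen from [D]. *)
Lemma separates_chain (D X : T) :
  clos_refl_trans_1n T separates D X ->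
  D = X \/ (X <> A /\ D <> A /\ D <> X /\ 2 * xi < dpi D A X).
Proof.
  assert (Hxi := xi_pos).
  intros H; induction H as [X | D C X HDC _ IH]; [left; reflexivity | right].
  assert (L := separates_large D C HDC); destruct HDC as (HDA & HCA & HDC & _).
  destruct IH as [-> | (HXA & _ & HCX & IH)]; [repeat split; auto; lra |].
  assert (n1 := behrstock C D A ltac:(auto) ltac:(auto) ltac:(auto)
                  ltac:(rewrite dpi_sym by auto; lra)).
  rewrite dpi_sym in n1 by auto.
  assert (HDX : D <> X) by (intros ->; lra).
  assert (t1 := dpi_triangle C A D X ltac:(auto) ltac:(auto) ltac:(auto)).
  assert (n2 := behrstock D C X ltac:(auto) ltac:(auto) ltac:(auto) ltac:(lra)).
  assert (t2 := dpi_triangle D A X C ltac:(auto) ltac:(auto) ltac:(auto)).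
  rewrite (dpi_sym D X C) in t2 by auto.
  repeat split; auto; lra.
Qed.

(** Induction peels off the link next to [X], a separator [C]. If [B] is [C] or [C] separates [B],
    then [D] is already below [B]; otherwise [B] separates [C] and the descent goes on. *)
Lemma separates_confluent (B D X : T) :
  separates B X -> clos_refl_trans_n1 T separates D X ->
  exists E, clos_refl_trans T separates E B /\ clos_refl_trans T separates E D.
Proof.
  intros HB H; revert B HB; induction H as [| C X HCX HDC IH]; intros B HB.
  - exists B; split; [apply rt_refl | apply rt_step; exact HB].
  - destruct (separates_comparable B C X HB HCX) as [-> | [HBC | HCB]].
    + exists D; split; [apply clos_rtn1_rt; exact HDC | apply rt_refl].
    + apply IH; exact HBC.
    + exists D; split; [| apply rt_refl].
      apply rt_trans with C; [apply clos_rtn1_rt; exact HDC | apply rt_step; exact HCB].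
Qed.

Definition far (X : T) : Prop := forall n, (n <= 2)%nat -> ~ walk adj n X A.

(** [B] is the first vertex after [A] on the path through [YK A X]. As [B] is not adjacent to [X],
    passing from [X] to [X'] costs at most [4 * xi] of [dpi B A X > 8 * xi]. *)
Lemma adj_common_separator (X X' : T) :
  far X -> far X' -> adj X X' -> exists B, separates B X /\ separates B X'.
Proof.
  intros HX HX' Hadj; assert (Hxi := xi_pos).
  assert (Hne : forall Y, far Y -> Y <> A /\ ~ adj Y A).
  { intros Y HY; split.
    - intros ->; apply (HY 0%nat); [lia | apply walk0].
    - intros H; apply (HY 1%nat); [lia | apply walk_adj, H]. }
  destruct (Hne X HX) as [HXA HXn], (Hne X' HX') as [HX'A HX'n].
  assert (Hj := YK_joined A X ltac:(auto)).
  inversion Hj as [? ? Heq | a B c _ HAB HBX]; subst; [congruence |].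
  (* Since [B] is a neighbour of [A], a vertex at distance more than 2 from [A] is neither [B] nor
     adjacent to it. *)
  assert (HBX' : forall Y, far Y -> Y <> B /\ ~ adj B Y).
  { intros Y HY; split.
    - intros ->; apply (proj2 (Hne B HY)), PK_adj_sym; exact HAB.
    - intros H; apply (HY 2%nat); [lia |].
      apply walkS with B; [apply PK_adj_sym; exact H | apply walk_adj, PK_adj_sym; exact HAB]. }
  destruct (HBX' X HX) as [HXB HBXn], (HBX' X' HX') as [HX'B _].
  destruct (proj1 (joined_ends _ _ _ _ HBX)) as [-> | [-> | HB]];
    [destruct (proj1 HAB); reflexivity | congruence |].
  assert (HBA : B <> A) by apply HB.
  assert (Hlt := inYK_lt_dpi _ _ _ _ HB).
  assert (Hs := adj_far_small B X X' HXB HX'B HBXn Hadj).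
  assert (t := dpi_triangle B A X' X ltac:(auto) ltac:(auto) ltac:(auto)).
  rewrite (dpi_sym B X' X) in t by auto.
  exists B; split; (split; [exact HBA | split; [assumption | split; [auto | split; [lra |]]]]).
  - exists X; repeat split; auto; lra.
  - exists X'; repeat split; auto; lra.
Qed.

Lemma far_joined_lower_bound (X Z : T) :
  joined adj far X Z ->
  exists D, clos_refl_trans T separates D X /\ clos_refl_trans T separates D Z.
Proof.
  intros H; induction H as [X HX | X Y Z HX HXY HYZ [D [HDY HDZ]]].
  - exists X; split; apply rt_refl.
  - destruct (adj_common_separator X Y HX (proj1 (joined_ends _ _ _ _ HYZ)) HXY)
      as [B [HBX HBY]].
    destruct (separates_confluent B D Y HBY (clos_rt_rtn1 _ _ _ _ HDY)) as [E [HEB HED]].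
    exists E; split.
    + apply rt_trans with B; [exact HEB | apply rt_step; exact HBX].
    + apply rt_trans with D; assumption.
Qed.

(** [D] sees [A] far from [X] and from [Z], so [A] sees [D] within [xi] of each, unless [D] is one
    of them. *)
Lemma far_joined_small (X Z : T) :
  X <> Z -> X <> A -> Z <> A -> joined adj far X Z -> dpi A X Z < 2 * xi.
Proof.
  intros HXZ HXA HZA Hj; assert (Hxi := xi_pos).
  destruct (far_joined_lower_bound X Z Hj) as [D [HDX HDZ]].
  assert (near : forall W, clos_refl_trans T separates D W ->
            D = W \/ (D <> A /\ dpi A D W < xi)).
  { intros W HW.
    destruct (separates_chain D W (clos_rt_rt1n _ _ _ _ HW)) as [-> | (HWA & HDA & HDW & Hlt)];
      [left; reflexivity | right].
    split; [exact HDA | apply behrstock; auto; lra]. }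
  destruct (near X HDX) as [-> | [HDA nX]], (near Z HDZ) as [HDZ' | [HDA' nZ]].
  - contradiction.
  - lra.
  - subst D; rewrite dpi_sym by auto; lra.
  - assert (t := dpi_triangle A X D Z ltac:(auto) ltac:(auto) ltac:(auto)).
    rewrite (dpi_sym A X D) in t by auto; lra.
Qed.

End Barrier.

Lemma PK_bottleneck : bottleneck adj 2.
Proof.
  intros X Z; assert (Hxi := xi_pos).
  destruct (classic (X = Z)) as [<- | HXZ].
  - exists (eq X); split; [apply joined_refl; reflexivity |].
    intros y <- Q HQ; exists X, 0%nat; split; [apply (joined_ends _ _ _ _ HQ) |].
    split; [lia | apply walk0].
  - exists (fun v => v = X \/ v = Z \/ YK X Z v); split; [apply YK_joined; exact HXZ |].
    intros Y HY Q HQ; destruct (joined_ends _ _ _ _ HQ) as [QX QZ].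
    destruct HY as [-> | [-> | HY]].
    + exists X, 0%nat; split; [exact QX | split; [lia | apply walk0]].
    + exists Z, 0%nat; split; [exact QZ | split; [lia | apply walk0]].
    (* Otherwise [Q] avoids the ball of radius 2 about [Y], so [dpi Y X Z < 2 * xi], although [Y] in
       [YK X Z] forces it above [K]. *)
    + apply NNPP; intros Hno.
      assert (Hfar : joined adj (far Y) X Z).
      { apply joined_imp with (2 := HQ); intros q Hq n Hn Hw.
        apply Hno; exists q, n; auto. }
      assert (Hlt := inYK_lt_dpi _ _ _ _ HY).
      assert (H := far_joined_small Y X Z HXZ (not_eq_sym (proj1 HY))
                     (not_eq_sym (proj1 (proj2 HY))) Hfar); lra.
Qed.

End LargeK.

End Projections.

Theorem theorem2p9 (T : Type) (dpi : T -> T -> T -> R) (xi : R) :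
  projection_axioms dpi xi ->
  exists K0 : R, forall K : R, K0 <= K -> quasi_tree (PK_adj dpi xi K).
Proof.
  (* [8 * xi] is the [4 * xi] lost in [adj_far_small] plus the [4 * xi] required by [separates]. *)
  intros Hax; exists (8 * xi); intros K HK.
  apply quasi_tree_of_bottleneck with 2%nat.
  - intros X Z; apply PK_adj_sym, Hax.
  - apply PK_bottleneck; assumption.
Qed.
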